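(* Let $S$ be a semigroup and let $k$ be a nonnegative integer. The enhanced power graph $\mathcal{P}_e(S)$ is $k$-regular if and only if $S$ is the union of mutually disjoint monogenic subsemigroups of $S$, each of size $k+1$.
   Context: For $z \in S$, $\langle z \rangle = \{z^m : m \geq 1\}$ is the subsemigroup generated by $z$; a subsemigroup of $S$ is monogenic if it equals $\langle a \rangle$ for some $a \in S$. The enhanced power graph $\mathcal{P}_e(S)$ of a semigroup $S$ is the simple undirected graph with vertex set $S$ in which two distinct vertices $x, y$ are adjacent if and only if $x, y \in \langle z \rangle$ for some $z \in S$. A graph is $k$-regular if every vertex has exactly $k$ neighbours. *)

(* Defs.v *)
From HB Require Import structures.
From mathcomp Require Import all_boot.
From mathcomp Require Import boolp classical_sets cardinality.

Set Implicit Arguments.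
Unset Strict Implicit.
Unset Printing Implicit Defensive.

Local Open Scope classical_set_scope.
Local Open Scope card_scope.

Record simple_graph (V : Type) := SimpleGraph {
  adj : V -> V -> Prop;
  adj_sym : forall x y, adj x y -> adj y x;
  adj_irrefl : forall x, ~ adj x x
}.

Definition neighbours (V : Type) (G : simple_graph V) (x : V) : set V :=
  [set y | adj G x y].

(* `I_k is the set {0, ..., k - 1} of naturals; #= is equipotence, so the
   neighbourhoods of a k-regular graph are finite even when V is infinite. *)
Definition regular_graph (V : Type) (k : nat) (G : simple_graph V) : Prop :=
  forall x : V, neighbours G x #= `I_k.

Section Semigroups.
Variable S : semigroupType.
Implicit Types (x y z : S) (A : set S) (m : nat).

(* z^m for m >= 1.  A semigroup has no unit, so the library's _ ^+ _ does not
   apply; the last argument of iterop is only the (unused) value at m = 0. *)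
Definition spow z m : S := iterop m (fun x y => x * y)%g z z.

Definition monogen z : set S := [set spow z m | m in [set m | 1 <= m]].

Definition is_subsemigroup A : Prop :=
  A !=set0 /\ forall x y, A x -> A y -> A (x * y)%g.

Definition monogenic_subsemigroup A : Prop :=
  is_subsemigroup A /\ exists a, A = monogen a.

Definition epg_adj x y : Prop :=
  x <> y /\ exists z, monogen z x /\ monogen z y.

Lemma epg_adj_sym x y : epg_adj x y -> epg_adj y x.
Proof.
by case=> xy [z [zx zy]]; split; [move=> /esym | exists z].
Qed.

Lemma epg_adj_irrefl x : ~ epg_adj x x.
Proof. by case. Qed.

Definition enhanced_power_graph : simple_graph S :=
  SimpleGraph epg_adj_sym epg_adj_irrefl.

End Semigroups.

Arguments enhanced_power_graph : clear implicits.

(* Main.v *)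
(** If the graph is k-regular, each closed neighbourhood N[x] has k + 1 elements
    and contains every monogenic subsemigroup through x.  Hence among those there
    is one, <z>, of maximal size; by maximality N[z] = <z>, so <z> has k + 1
    elements, and N[y] = <z> for every y in <z> by counting.  The closed
    neighbourhoods are therefore the required disjoint monogenic subsemigroups.
    Conversely, in a disjoint union of monogenic subsemigroups every <z> lies in
    the part containing z, so the part containing x is exactly N[x]. *)
Require Import Defs.
From HB Require Import structures.
From mathcomp Require Import all_boot.
From mathcomp Require Import finmap.
From mathcomp Require Import boolp classical_sets cardinality.

Local Open Scope classical_set_scope.
Local Open Scope card_scope.

Lemma card_sub_leq {T : choiceType} {A B : set T} {n m : nat} :
  A `<=` B -> A #= `I_n -> B #= `I_m -> n <= m.
Proof.
move=> sAB An Bm; rewrite -(card_fset_set An) -(card_fset_set Bm).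
have fA : finite_set A by apply/finite_setP; exists n.
have fB : finite_set B by apply/finite_setP; exists m.
by apply: fsubset_leq_card; rewrite -fset_set_sub.
Qed.

(** Passing to [fset_set], a finite set has no proper subset at least as large as itself. Each
    equality obtained by counting below comes from this. *)
Lemma card_sub_eq {T : choiceType} {A B : set T} {n m : nat} :
  A `<=` B -> A #= `I_n -> B #= `I_m -> m <= n -> A = B.
Proof.
move=> sAB An Bm le_mn.
have fA : finite_set A by apply/finite_setP; exists n.
have fB : finite_set B by apply/finite_setP; exists m.
apply: fset_set_inj; rewrite ?inE //; apply/eqP; rewrite eqEfcard.
apply/andP; split; last by rewrite (card_fset_set An) (card_fset_set Bm).
by rewrite -fset_set_sub.
Qed.

Section EnhancedPowerGraph.
Variable S : semigroupType.
Implicit Types (x y z : S) (m n : nat).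

(** Positivity matters: [spow z 0] is the default value [z], for which this law can fail. *)
Lemma spowD z m n : 0 < m -> 0 < n -> (spow z m * spow z n)%g = spow z (m + n).
Proof.
case: m n => // m [//|n] _ _; rewrite /spow addSn addnS !iteropS.
by elim: m => [|m IHm] //=; rewrite -mulgA IHm.
Qed.

Lemma spowM z m n : 0 < m -> 0 < n -> spow (spow z m) n = spow z (m * n).
Proof.
move=> m_gt0; case: n => // n _; elim: n => [|n IHn]; first by rewrite muln1.
by rewrite mulnS -spowD ?muln_gt0 ?m_gt0 // -IHn /spow !iteropS.
Qed.

Lemma monogen_refl z : monogen z z.
Proof. by exists 1. Qed.

Lemma monogen_sub {z x} : monogen z x -> monogen x `<=` monogen z.
Proof.
move=> [m /= m_gt0 <-] _ [n /= n_gt0 <-].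
by exists (m * n); rewrite ?spowM //= muln_gt0 m_gt0.
Qed.

Lemma monogen_mul z x y : monogen z x -> monogen z y -> monogen z (x * y)%g.
Proof.
move=> [m /= m_gt0 <-] [n /= n_gt0 <-].
by exists (m + n); rewrite ?spowD //= addn_gt0 m_gt0.
Qed.

Lemma monogen_subsemigroup z : monogenic_subsemigroup (monogen z).
Proof.
split; last by exists z.
by split; [exists z; apply: monogen_refl | apply: monogen_mul].
Qed.

Lemma monogen_min {A : set S} {z} : is_subsemigroup A -> A z -> monogen z `<=` A.
Proof.
move=> [_ mulA] Az _ [[//|m] _ <-]; rewrite /spow iteropS.
by elim: m => //= m IHm; apply: mulA.
Qed.

Definition closed_nbhd x : set S := [set y | exists z, monogen z x /\ monogen z y].

Lemma closed_nbhd_refl x : closed_nbhd x x.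
Proof. by exists x; split; apply: monogen_refl. Qed.

Lemma monogen_closed_nbhd {z x} : monogen z x -> monogen z `<=` closed_nbhd x.
Proof. by move=> zx y zy; exists z. Qed.

Lemma closed_nbhdD1 x :
  closed_nbhd x `\ x = neighbours (enhanced_power_graph S) x.
Proof.
apply/seteqP; split=> y /=; first by move=> [xy yx]; split=> // /esym.
by move=> [yx xy]; split=> // /esym.
Qed.

Lemma card_closed_nbhd k x :
  closed_nbhd x #= `I_k.+1 <->
  neighbours (enhanced_power_graph S) x #= `I_k.
Proof.
rewrite -closed_nbhdD1; split=> [Nk|Nk]; last first.
  by apply/eq_cardSP; exists x => //; apply: closed_nbhd_refl.
(* Applied to [Nk], [eq_cardSP] would only remove some point, not necessarily [x]. So the punctured
   set gets its own size [n], and putting [x] back forces [n = k]. *)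
have fN : finite_set (closed_nbhd x `\ x).
  by apply: finite_setD; apply/finite_setP; exists k.+1.
have [n Nn] := (finite_setP _).1 fN.
have : closed_nbhd x #= `I_n.+1.
  by apply/eq_cardSP; exists x => //; apply: closed_nbhd_refl.
by rewrite (card_eql Nk) => /card_eq_II[->].
Qed.

Lemma closed_nbhd_monogen {k} x :
  (forall y, closed_nbhd y #= `I_k.+1) ->
  exists z, monogen z x /\ closed_nbhd x = monogen z.
Proof.
move=> regS.
have card_mon z : exists n, monogen z #= `I_n.
  apply/finite_setP; apply: (sub_finite_set (monogen_closed_nbhd (monogen_refl z))).
  by apply/finite_setP; exists k.+1.
(* The sizes of the monogenic subsemigroups through [x]: [monogen x] gives one, and all are at most
   k + 1 by inclusion in [closed_nbhd x], so a maximum exists. *)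
pose P n := `[< exists z, monogen z x /\ monogen z #= `I_n >].
have exP : exists n, P n.
  have [n xn] := card_mon x; exists n; apply/asboolP.
  by exists x; split=> //; apply: monogen_refl.
have ubP n : P n -> n <= k.+1.
  move=> /asboolP[z [zx zn]].
  exact: card_sub_leq (monogen_closed_nbhd zx) zn (regS x).
case: (ex_maxnP exP ubP) => n /asboolP[z [zx zn]] maxn.
exists z; split=> //.
have Nz : closed_nbhd z = monogen z.
  apply/seteqP; split; last exact/monogen_closed_nbhd/monogen_refl.
  move=> y [w [wz wy]]; have [m wm] := card_mon w.
  (* Since [monogen w] contains [z], it contains [monogen z] and hence [x], so it competes for the
     maximum. *)
  have le_mn : m <= n.
    by apply/maxn/asboolP; exists w; split=> //; apply: monogen_sub wz x zx.
  by rewrite (card_sub_eq (monogen_sub wz) zn wm le_mn).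
have zk : monogen z #= `I_k.+1 by rewrite -Nz.
by rewrite (card_sub_eq (monogen_closed_nbhd zx) zk (regS x)).
Qed.

Lemma closed_nbhd_part {M : set (set S)} {A : set S} {x} :
  (forall B, M B -> monogenic_subsemigroup B) ->
  (forall B C, M B -> M C -> B <> C -> B `&` C = set0) ->
  \bigcup_(B in M) B = [set: S] ->
  M A -> A x -> closed_nbhd x = A.
Proof.
move=> monM disjM covM MA Ax; apply/seteqP; split; last first.
  have [_ [a Aa]] := monM _ MA.
  by rewrite Aa; apply: monogen_closed_nbhd; rewrite -Aa.
move=> y [z [zx zy]].
(* The part [B] containing [z] is closed under products, so it contains both [x] and [y]; as [x] is
   also in [A], disjointness forces [A = B]. *)
have [B MB Bz] : (\bigcup_(B in M) B) z by rewrite covM.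
have sB := monogen_min (monM _ MB).1 Bz.
have [->|AB] := pselect (A = B); first exact: sB.
have : (A `&` B) x by split=> //; apply: sB.
by rewrite disjM.
Qed.

End EnhancedPowerGraph.

Arguments closed_nbhd {S} x.

Theorem theorem3p11 (S : semigroupType) (k : nat) :
  regular_graph k (enhanced_power_graph S) <->
  exists M : set (set S),
    [/\ forall A : set S, M A -> monogenic_subsemigroup A /\ A #= `I_k.+1,
        forall A B : set S, M A -> M B -> A <> B -> A `&` B = set0
      & \bigcup_(A in M) A = [set: S]].
Proof.
split=> [regS | [M [monM disjM covM]] x]; last first.
  have [A MA Ax] : (\bigcup_(A in M) A) x by rewrite covM.
  apply/card_closed_nbhd.
  rewrite (closed_nbhd_part _ _ disjM covM MA Ax) //; first by have [] := monM _ MA.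
  by move=> B /monM[].
have cardN (x : S) : closed_nbhd x #= `I_k.+1 := (card_closed_nbhd S k x).2 (regS x).
have NE (x y : S) : closed_nbhd x y -> closed_nbhd y = closed_nbhd x.
  (* As [y] lies in [monogen z], that set is included in [closed_nbhd y], and both have k + 1
     elements. *)
  have [z [_ Nx]] := closed_nbhd_monogen _ x cardN.
  rewrite Nx => zy; apply/esym.
  apply: card_sub_eq (monogen_closed_nbhd _ zy) _ (cardN y) (leqnn _).
  by rewrite -Nx.
exists (range (@closed_nbhd S)); split.
- move=> _ [x _ <-]; split=> //.
  by have [z [_ ->]] := closed_nbhd_monogen _ x cardN; apply: monogen_subsemigroup.
- move=> _ _ [x _ <-] [y _ <-] xy; apply/seteqP; split=> // z [xz yz].
  (* A common point [z] would make both neighbourhoods equal to [closed_nbhd z]. *)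
  by case: xy; rewrite -(NE _ _ xz) -(NE _ _ yz).
- apply/seteqP; split=> // x _.
  by exists (closed_nbhd x); [exists x | apply: closed_nbhd_refl].
Qed.
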